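(* $z_{NC}\leq 2z_{OPT}$, where $z_{NC}$ is the optimal objective value of the non-convex relaxation and $z_{OPT}$ is the optimal objective value of the chance-constrained binary knapsack problem (CKP).
   Context: Let $N=\{1,\dots,n\}$ be a set of items. Each $j\in N$ has a profit $c_j>0$ and a random weight $\tilde a_j\sim\mathcal N(a_j,\sigma_j^2)$ with $a_j>0$, $\sigma_j\ge 0$ (if $\sigma_j=0$ the weight is the constant $a_j$); the weights $\tilde a_j$ are mutually independent. The capacity is $b>0$, the probability threshold is $\rho\in[0.5,1)$, and $\Phi^{-1}$ is the inverse of the standard normal cumulative distribution function. Standing assumptions: $\sum_{j\in N}a_j+\Phi^{-1}(\rho)\sqrt{\sum_{j\in N}\sigma_j^2}>b$, and $a_j+\Phi^{-1}(\rho)\sigma_j\le b$ for each $j\in N$. CKP: $z_{OPT}=\max\{\sum_{j\in N}c_jx_j: x\in\{0,1\}^n,\ \mathbb{P}\{\sum_{j\in N}\tilde a_jx_j\le b\}\ge\rho\}$. Equivalently, the chance constraint may be written as $\sum_{j\in N}a_jx_j+\Phi^{-1}(\rho)\sqrt{\sum_{j\in N}\sigma_j^2x_j^2}\le b$. Non-convex relaxation: $z_{NC}=\max\{\sum_{j\in N}c_jx_j: x\in[0,1]^n,\ g(x)\le b\}$, where $g(x)=\sum_{j\in N}a_jx_j+\Phi^{-1}(\rho)\sqrt{\sum_{j\in N}\sigma_j^2x_j}$. *)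

(* Defs.v *)
From HB Require Import structures.
From mathcomp Require Import all_boot all_order all_algebra.
From mathcomp Require Import all_classical all_reals all_analysis.

Set Implicit Arguments.
Unset Strict Implicit.
Unset Printing Implicit Defensive.

Import Order.TTheory GRing.Theory Num.Theory.
Import numFieldNormedType.Exports.

Local Open Scope classical_set_scope.
Local Open Scope ring_scope.

Definition Phi {R : realType} (x : R) : R := fine (normal_prob 0 1 `]-oo, x]).

(* [Phi] is a bijection from R onto ]0, 1[, so for p in ]0, 1[ this is the
   unique x such that Phi x = p; the default 0 only concerns other p. *)
Definition Phi_inv {R : realType} (p : R) : R := xget 0 [set x | Phi x = p].

(* X ~ N(m, s^2), with s the standard deviation. The case s = 0 (X = m almost
   surely) is treated apart because [normal_prob m 0] is a junk value. *)
Definition has_normal_law d (T : measurableType d) (R : realType)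
    (P : probability T R) (X : {RV P >-> R}) (m s : R) : Prop :=
  forall B : set R, measurable B ->
    distribution P X B = if s == 0 then dirac m B else normal_prob m s B.

Arguments has_normal_law {d T R} P X m s.

Definition mutually_independent d (T : measurableType d) (R : realType)
    (P : probability T R) (n : nat) (X : 'I_n -> {RV P >-> R}) : Prop :=
  forall (J : {set 'I_n}) (B : 'I_n -> set R),
    (forall j, measurable (B j)) ->
    P [set w | forall j, j \in J -> B j (X j w)] =
    (\prod_(j in J) P (X j @^-1` B j))%E.

Arguments mutually_independent {d T R} P {n} X.

Definition profit {R : realType} (n : nat) (c x : 'I_n -> R) : R :=
  \sum_(j < n) c j * x j.

Definition CKP_feasible d (T : measurableType d) (R : realType)
    (P : probability T R) (n : nat) (atil : 'I_n -> {RV P >-> R}) (b rho : R) :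
    set ('I_n -> R) :=
  [set x | (forall j, x j = 0 \/ x j = 1) /\
           (rho%:E <= P [set w | (\sum_(j < n) atil j w * x j <= b)%R])%E].

Arguments CKP_feasible {d T R} P {n} atil b rho.

Definition g_NC {R : realType} (n : nat) (a sigma : 'I_n -> R) (rho : R)
    (x : 'I_n -> R) : R :=
  \sum_(j < n) a j * x j
  + Phi_inv rho * Num.sqrt (\sum_(j < n) sigma j ^+ 2 * x j).

Definition NC_feasible {R : realType} (n : nat) (a sigma : 'I_n -> R)
    (b rho : R) : set ('I_n -> R) :=
  [set x | (forall j, 0 <= x j <= 1) /\ g_NC a sigma rho x <= b].

(* The suprema below are maxima as soon as 0 < b (and rho <= 1), see
   [z_OPT_max] and [z_NC_max]. *)
Definition z_OPT d (T : measurableType d) (R : realType) (P : probability T R)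
    (n : nat) (c : 'I_n -> R) (atil : 'I_n -> {RV P >-> R}) (b rho : R) : R :=
  sup (profit c @` CKP_feasible P atil b rho).

Arguments z_OPT {d T R} P {n} c atil b rho.

Definition z_NC {R : realType} (n : nat) (c a sigma : 'I_n -> R) (b rho : R) :
    R :=
  sup (profit c @` NC_feasible a sigma b rho).

Definition is_max {R : realType} (A : set R) (z : R) : Prop :=
  A z /\ ubound A z.

Lemma sup_is_max {R : realType} (A : set R) z : is_max A z -> is_max A (sup A).
Proof.
move=> [Az ubz]; suff -> : sup A = z by [].
apply/eqP; rewrite eq_le; apply/andP; split.
  by apply: ge_sup => //; exists z.
by apply: ub_le_sup => //; exists z.
Qed.

Lemma z_OPT_max d (T : measurableType d) (R : realType) (P : probability T R)
    (n : nat) (c : 'I_n -> R) (atil : 'I_n -> {RV P >-> R}) (b rho : R) :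
  0 < b -> rho <= 1 ->
  is_max (profit c @` CKP_feasible P atil b rho) (z_OPT P c atil b rho).
Proof.
move=> b0 rho1.
pose v (A : {set 'I_n}) : 'I_n -> R := fun j => (j \in A)%:R.
have v0 : CKP_feasible P atil b rho (v finset.set0).
  split=> [j|]; first by rewrite /v inE; left.
  rewrite (_ : [set w | _] = setT) ?probability_setT ?lee_fin//.
  apply/seteqP; split=> // w _ /=.
  by rewrite big1 ?ltW// => j _; rewrite /v inE mulr0.
have v0' : `[< CKP_feasible P atil b rho (v finset.set0) >] by exact/asboolP.
have [A /asboolP Af Amax] := Order.TotalTheory.arg_maxP
  (P := fun A => `[< CKP_feasible P atil b rho (v A) >])
  (fun A => profit c (v A)) v0'.
apply: (@sup_is_max _ _ (profit c (v A))); split; first by exists (v A).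
move=> _ [x xf <-].
have xE : x = v [set j | x j == 1]%SET.
  apply/funext => j; rewrite /v inE; case: xf => /(_ j) [|] -> _.
    by rewrite eq_sym oner_eq0.
  by rewrite eqxx.
by rewrite xE; apply: Amax; apply/asboolP; rewrite -xE.
Qed.

Lemma continuous_lincomb {R : realType} (T : topologicalType) (n : nat)
    (u : 'I_n -> R) (F : 'I_n -> T -> R) :
  (forall j, continuous (F j)) ->
  continuous (fun x => \sum_(j < n) u j * F j x).
Proof.
move=> cF; apply: (@continuous_big R _ +%R) => [|j _ x].
  exact: add_continuous.
by apply: cvgM; [exact: cvg_cst|exact: cF].
Qed.

Lemma continuous_risk {R : realType} (T : topologicalType) (q : R)
    (f h : T -> R) : continuous f -> continuous h ->
  continuous (fun x => f x + q * Num.sqrt (h x)).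
Proof.
move=> cf ch x; apply: cvgD; first exact: cf.
apply: cvgM; first exact: cvg_cst.
exact: (continuous_comp (ch x) (@sqrt_continuous R (h x))).
Qed.

Lemma z_NC_max {R : realType} (n : nat) (c a sigma : 'I_n -> R) (b rho : R) :
  0 < b -> is_max (profit c @` NC_feasible a sigma b rho)
                  (z_NC c a sigma b rho).
Proof.
move=> b0; pose T := prod_topology (fun _ : 'I_n => R).
have cproj j : continuous (fun x : T => x j).
  exact: (@proj_continuous 'I_n (fun=> R) j).
have csum (u : 'I_n -> R) : continuous (fun x : T => \sum_(j < n) u j * x j).
  exact: (@continuous_lincomb R T n u (fun j x => x j) cproj).
have cg : continuous (g_NC a sigma rho : T -> R).
  exact: (@continuous_risk R T (Phi_inv rho) _ _ (csum a)
            (csum (fun j => sigma j ^+ 2))).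
pose K : set T := [set x | forall j, `[0, 1]%classic (x j)].
have cK : compact K.
  apply: (@tychonoff 'I_n (fun=> R) (fun=> `[0, 1]%classic)) => j.
  exact: segment_compact.
have FE : NC_feasible a sigma b rho =
    K `&` ((g_NC a sigma rho : T -> R) @^-1` [set y | y <= b]).
  apply/seteqP; split=> x /= [xK xb]; split=> // j; have := xK j;
    by rewrite /= in_itv.
have cF : compact (NC_feasible a sigma b rho : set T).
  rewrite FE; apply: (compact_closedI cK).
  apply: (@preimage_closed T R (g_NC a sigma rho) [set y | y <= b]).
    by move=> x _; exact: cg.
  exact: closed_le.
have F0 : (NC_feasible a sigma b rho : set T) !=set0.
  exists (fun=> 0); split=> [j|]; first by rewrite lexx ler01.
  rewrite /g_NC !big1; [|by move=> j _; rewrite mulr0..].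
  by rewrite sqrtr0 mulr0 addr0 ltW.
have [x xF xmax] : exists2 x, x \in (NC_feasible a sigma b rho : set T) &
    forall t, t \in (NC_feasible a sigma b rho : set T) ->
      profit c t <= profit c x.
  apply: (compact_EVT_max F0 cF); apply: continuous_subspaceT; exact: csum.
apply: (@sup_is_max _ _ (profit c x)).
split; first by exists x => //; rewrite inE in xF.
by move=> _ [t tF <-]; apply: xmax; rewrite inE.
Qed.

(* Main.v *)
Require Import Defs.
From HB Require Import structures.
From mathcomp Require Import all_boot all_order all_algebra.
From mathcomp Require Import all_classical all_reals all_analysis.
From mathcomp Require Import measurable_realfun ring lra.

(** Why the theorem holds.

    Write q for [Phi_inv rho]; since rho >= 1/2, q >= 0 ([Phi_inv_ge0]), and
    then [g_NC] is concave, being a linear function plus q times the square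
    root of one. Let x be optimal for the relaxation. If two coordinates i and
    k of x are fractional, move x along the line that trades item i against
    item k at equal profit. On the segment of that line inside the box, the
    concave [g_NC] is minimal at an end, so some end is still feasible; it has
    the same profit and one fractional coordinate fewer. Iterating
    ([round_to_one_fractional]) leaves at most one fractional item k. Dropping
    k gives a 0/1 point, feasible because [g_NC] is monotone, and the single
    item k is feasible because a k + q * sigma k <= b. The profit of x is at
    most the sum of the profits of these two 0/1 points, hence at most twice
    the best one ([NC_profit_le_double]).

    It remains to see that a 0/1 point y with g_NC y <= b satisfies the chance
    constraint ([g_NC_chance_constraint]). For such y, y j ^+ 2 = y j, so
    [g_NC] involves exactly the mean and the standard deviation of the total
    weight, and the claim is the usual quantile computation once the total
    weight is known to be normal. The latter is proved by adding one item at a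
    time ([law_sum_indep]). By independence, the joint law of the partial sum
    and the new weight is a product measure ([joint_law_product]), and the
    image of a product of two normal laws under addition is normal
    ([normal_law_convolution]): completing the square factors the product of
    the two densities into the density of the sum and a normal density in the
    integration variable, whose integral is 1 ([normal_pdf_convolution]). *)

Set Implicit Arguments.
Unset Strict Implicit.
Unset Printing Implicit Defensive.

Import Order.TTheory GRing.Theory Num.Theory.
Import numFieldNormedType.Exports.
Local Open Scope classical_set_scope.
Local Open Scope ring_scope.

(** * Rounding a point of the relaxation *)

Lemma concave_sqrt (R : rcfType) (u v l k : R) :
  0 <= u -> 0 <= v -> 0 <= l -> 0 <= k -> l + k = 1 ->
  l * Num.sqrt u + k * Num.sqrt v <= Num.sqrt (l * u + k * v).
Proof.
move=> u0 v0 l0 k0 lk.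
have su := sqrtr_ge0 u; have sv := sqrtr_ge0 v.
have uE := sqr_sqrtr u0; have vE := sqr_sqrtr v0.
set p := Num.sqrt u in su uE *; set r := Num.sqrt v in sv vE *.
rewrite -[leLHS]ger0_norm; last by rewrite addr_ge0 ?mulr_ge0.
rewrite -sqrtr_sqr; apply: ler_wsqrtr.
rewrite -uE -vE -subr_ge0 (_ : _ - _ = l * k * (p - r) ^+ 2).
  by rewrite mulr_ge0 ?sqr_ge0// mulr_ge0.
have -> : k = 1 - l by lra.
ring.
Qed.

Definition concave_on_box {R : realType} (n : nat) (h : ('I_n -> R) -> R) :=
  forall (x y : 'I_n -> R) (l k : R), (forall j, 0 <= x j <= 1) ->
    (forall j, 0 <= y j <= 1) -> 0 <= l -> 0 <= k -> l + k = 1 ->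
    l * h x + k * h y <= h (fun j => l * x j + k * y j).

(** [g_NC] is linear up to [Phi_inv rho] times the square root of a linear
    function, so the sign of [Phi_inv rho] decides between concavity and
    convexity. *)
Lemma concave_on_box_g_NC (R : realType) (n : nat) (a sigma : 'I_n -> R)
    (rho : R) : 0 <= Phi_inv rho -> concave_on_box (g_NC a sigma rho).
Proof.
move=> q0 x y l k x01 y01 l0 k0 lk; rewrite /g_NC.
have lin (u : 'I_n -> R) : \sum_(j < n) u j * (l * x j + k * y j) =
    l * (\sum_(j < n) u j * x j) + k * (\sum_(j < n) u j * y j).
  by rewrite !mulr_sumr -big_split/=; apply: eq_bigr => j _; ring.
rewrite !lin.
have pos (z : 'I_n -> R) : (forall j, 0 <= z j <= 1) ->
    0 <= \sum_(j < n) sigma j ^+ 2 * z j.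
  by move=> z01; apply: sumr_ge0 => j _; rewrite mulr_ge0 ?sqr_ge0//; case/andP: (z01 j).
have := concave_sqrt (pos x x01) (pos y y01) l0 k0 lk.
move=> /(ler_wpM2l q0); lra.
Qed.

Definition fractional {R : realType} (n : nat) (x : 'I_n -> R) : {set 'I_n} :=
  [set j | 0 < x j < 1]%SET.

Section exchange.
Context {R : realType} (n : nat) (c : 'I_n -> R).
Hypothesis c_gt0 : forall j, 0 < c j.

(** Item i gains what item k loses, measured in profit rather than in
    quantity; this is why t is divided by the unit profits. *)
Definition trade (x : 'I_n -> R) (i k : 'I_n) (t : R) : 'I_n -> R :=
  fun j => if j == i then x j + t / c j else
           if j == k then x j - t / c j else x j.

(** The largest trade that keeps both coordinates in the unit interval. *)
Definition max_trade (x : 'I_n -> R) (i k : 'I_n) : R :=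
  Num.min ((1 - x i) * c i) (x k * c k).

Lemma profit_trade x i k t : i != k -> profit c (trade x i k t) = profit c x.
Proof.
move=> ik; have ki : k != i by rewrite eq_sym.
rewrite /profit (bigD1 i)//= (bigD1 k)//= [RHS](bigD1 i)//= [in RHS](bigD1 k)//=.
rewrite /trade eqxx (negbTE ki) eqxx.
rewrite (eq_bigr (fun j => c j * x j)) => [|j /andP[/negbTE -> /negbTE ->]//].
by field; rewrite !gt_eqF.
Qed.

Lemma trade_box x i k t : i != k -> (forall j, 0 <= x j <= 1) ->
  0 <= t <= max_trade x i k -> forall j, 0 <= trade x i k t j <= 1.
Proof.
move=> ik x01; rewrite /max_trade le_min => /and3P[t0 ti tk] j.
rewrite /trade.
have /andP[xj0 xj1] := x01 j.
have tcj : 0 <= t / c j by rewrite divr_ge0// ltW.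
case: eqVneq => [ji|_]; last case: eqVneq => [jk|_]; last exact: x01.
- subst j; move: ti; rewrite -ler_pdivrMr//; lra.
- subst j; move: tk; rewrite -ler_pdivrMr//; lra.
Qed.

Lemma max_trade_gt0 x i k : i \in fractional x -> k \in fractional x ->
  0 < max_trade x i k.
Proof.
rewrite /fractional !inE => /andP[xi0 xi1] /andP[xk0 xk1].
by rewrite /max_trade lt_min !mulr_gt0// subr_gt0.
Qed.

(** A maximal trade stops because item i reaches 1 or item k reaches 0, and no
    integral coordinate is touched. *)
Lemma fractional_max_trade x i k : i != k ->
  i \in fractional x -> k \in fractional x ->
  fractional (trade x i k (max_trade x i k)) \proper fractional x.
Proof.
move=> ik fi fk; have ki : k != i by rewrite eq_sym.
apply/properP; split.
  apply/fintype.subsetP => j; rewrite [in X in X -> _]/fractional inE /trade.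
  case: eqVneq => [->//|_]; case: eqVneq => [->//|_].
  by rewrite /fractional inE.
rewrite /max_trade; have [ik1|ki1] := leP ((1 - x i) * c i) (x k * c k).
- exists i => //; rewrite /fractional inE /trade eqxx mulfK ?gt_eqF//.
  by rewrite subrKC ltxx andbF.
- exists k => //; rewrite /fractional inE /trade (negbTE ki) eqxx.
  by rewrite mulfK ?gt_eqF// subrr ltxx.
Qed.

(** The point x lies on the segment between the maximal trade from k to i and
    the one from i to k, and a concave function on a segment cannot exceed its
    value at an interior point at both ends. *)
Lemma le_trade (h : ('I_n -> R) -> R) x i k : concave_on_box h -> i != k ->
  (forall j, 0 <= x j <= 1) ->
  i \in fractional x -> k \in fractional x ->
  h (trade x i k (max_trade x i k)) <= h x \/
  h (trade x k i (max_trade x k i)) <= h x.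
Proof.
move=> ch ik x01 fi fk; have ki : k != i by rewrite eq_sym.
have u0 := max_trade_gt0 fi fk; have v0 := max_trade_gt0 fk fi.
set u := max_trade x i k in u0 *; set v := max_trade x k i in v0 *.
have y01 : forall j, 0 <= trade x i k u j <= 1.
  by apply: trade_box => //; rewrite ltW/=.
have z01 : forall j, 0 <= trade x k i v j <= 1.
  by apply: trade_box => //; rewrite ltW/=.
have uv : 0 < u + v by rewrite addr_gt0.
(* Each end is weighted by the length of the opposite trade, which makes the
   two trades cancel. *)
have := ch _ _ (v / (u + v)) (u / (u + v)) y01 z01.
rewrite !divr_ge0 ?(ltW u0) ?(ltW v0) ?(ltW uv)// => /(_ isT isT).
rewrite -mulrDl [v + u]addrC divff ?gt_eqF// => /(_ erefl).
have -> : (fun j => v / (u + v) * trade x i k u j + u / (u + v) * trade x k i v j) = x.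
  apply/funext => j; rewrite /trade; have cj := c_gt0 j.
  case: eqVneq => [->|ji]; last case: eqVneq => [->|jk].
  - rewrite (negbTE ik); field; rewrite !gt_eqF//.
  - field; rewrite !gt_eqF//.
  - field; rewrite !gt_eqF//.
have [|lt1] := leP (h (trade x i k u)) (h x); first by left.
have [|lt2] := leP (h (trade x k i v)) (h x); first by right.
rewrite leNgt => /negP[].
rewrite [ltLHS](_ : _ = v / (u + v) * h x + u / (u + v) * h x); last first.
  by field; rewrite gt_eqF.
by rewrite ltrD// ltr_pM2l// divr_gt0.
Qed.

(** Any two fractional coordinates can be traded against each other, in the
    direction that does not increase h, until one of them is integral; the
    profit is constant along the way. *)
Lemma round_to_one_fractional (h : ('I_n -> R) -> R) (x : 'I_n -> R) :
  concave_on_box h -> (forall j, 0 <= x j <= 1) ->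
  exists y : 'I_n -> R, [/\ forall j, 0 <= y j <= 1, h y <= h x,
    profit c y = profit c x & (#|fractional y| <= 1)%N].
Proof.
move=> ch; have [m] := ubnP #|fractional x|.
elim: m x => [//|m IH] x fm x01.
have [|/card_gt1P[i [k [fi fk ik]]]] := leqP #|fractional x| 1; first by exists x.
have ki : k != i by rewrite eq_sym.
suff [y [yx y01 hy py]] : exists y, [/\ fractional y \proper fractional x,
    forall j, 0 <= y j <= 1, h y <= h x & profit c y = profit c x].
  have [|z [z01 hz pz fz]] := IH y _ y01.
    exact: leq_trans (proper_card yx) _.
  by exists z; split; rewrite ?pz//; exact: le_trans hz hy.
have box i' k' : i' != k' -> i' \in fractional x -> k' \in fractional x ->
    forall j, 0 <= trade x i' k' (max_trade x i' k') j <= 1.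
  by move=> ik' fi' fk'; apply: trade_box; rewrite ?lexx ?ltW ?max_trade_gt0.
by have [hle|hle] := le_trade ch ik x01 fi fk;
  [exists (trade x i k (max_trade x i k))|exists (trade x k i (max_trade x k i))];
  split; rewrite ?profit_trade ?fractional_max_trade//; exact: box.
Qed.

End exchange.

Lemma box_integral (R : realType) (t : R) : 0 <= t <= 1 -> ~~ (0 < t < 1) ->
  t = 0 \/ t = 1.
Proof.
move=> /andP[t0 t1]; rewrite negb_and -!leNgt => /orP[tl|tl]; [left|right];
by apply/eqP; rewrite eq_le ?tl ?t0 ?t1.
Qed.

Lemma g_NC_mono (R : realType) (n : nat) (a sigma : 'I_n -> R) (rho : R)
    (x y : 'I_n -> R) : 0 <= Phi_inv rho -> (forall j, 0 <= a j) ->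
  (forall j, x j <= y j) -> g_NC a sigma rho x <= g_NC a sigma rho y.
Proof.
move=> q0 a0 xy; rewrite /g_NC lerD//.
  by apply: ler_sum => j _; rewrite ler_wpM2l.
rewrite ler_wpM2l// ler_wsqrtr//; apply: ler_sum => j _.
by rewrite ler_wpM2l ?sqr_ge0.
Qed.

Lemma sum_mul_indicator (R : realType) (n : nat) (u : 'I_n -> R) (k : 'I_n) :
  \sum_(j < n) u j * (j == k)%:R = u k.
Proof.
rewrite (bigD1 k)//= eqxx mulr1 big1 ?addr0// => j /negbTE ->.
by rewrite mulr0.
Qed.

Lemma g_NC_single (R : realType) (n : nat) (a sigma : 'I_n -> R) (rho : R)
    (k : 'I_n) : 0 <= sigma k ->
  g_NC a sigma rho (fun j => (j == k)%:R) = a k + Phi_inv rho * sigma k.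
Proof. by move=> s0; rewrite /g_NC !sum_mul_indicator sqrtr_sqr ger0_norm. Qed.

(** After rounding, the profit splits into that of the integral items and that
    of the only fractional item; both are bounded by a feasible 0/1 point. The
    bound z is kept abstract so that this part involves no probability. *)
Lemma NC_profit_le_double (R : realType) (n : nat) (c a sigma : 'I_n -> R)
    (b rho z : R) (x : 'I_n -> R) :
  (forall j, 0 < c j) -> (forall j, 0 < a j) -> (forall j, 0 <= sigma j) ->
  0 <= Phi_inv rho -> (forall j, a j + Phi_inv rho * sigma j <= b) ->
  (forall y : 'I_n -> R, (forall j, y j = 0 \/ y j = 1) ->
     g_NC a sigma rho y <= b -> profit c y <= z) ->
  NC_feasible a sigma b rho x -> profit c x <= 2 * z.
Proof.
move=> c0 a0 s0 q0 hone zmax [x01 gx].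
have [y [y01 gy <- fy]] := round_to_one_fractional c0
  (concave_on_box_g_NC a sigma q0) x01.
have {}gy := le_trans gy gx.
have [f0|[k fk]] := set_0Vmem (fractional y).
  have yint j : y j = 0 \/ y j = 1.
    apply: box_integral => //.
    by have := finset.in_set0 j; rewrite -f0 /fractional inE => ->.
  have py : profit c y <= z by exact: zmax.
  have pz0 : 0 <= profit c y.
    by apply: sumr_ge0 => j _; rewrite mulr_ge0 ?(ltW (c0 j))//; case/andP: (y01 j).
  lra.
pose y' j := if j == k then 0 else y j.
have y'P j : y' j = 0 \/ y' j = 1.
  rewrite /y'; have [_|jk] := eqVneq j k; first by left.
  apply: box_integral => //; apply/negP => fj.
  move/card_le1P: fy => /(_ k fk) /(_ j); rewrite /fractional !inE fj.
  by rewrite (negbTE jk).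
have py' : profit c y' <= z.
  apply: zmax => //; apply: le_trans gy.
  apply: g_NC_mono => [//|j|j]; first exact: ltW.
  by rewrite /y'; case: eqP => // _; case/andP: (y01 j).
have pk : c k <= z.
  rewrite -[leLHS](sum_mul_indicator c k); apply: zmax.
    by move=> j; case: (j == k); [right|left].
  by rewrite g_NC_single.
have -> : profit c y = c k * y k + profit c y'.
  rewrite /profit (bigD1 k)//= [in RHS](bigD1 k)//= {1}/y' eqxx mulr0 add0r.
  by congr (_ + _); apply: eq_bigr => j /negbTE jk; rewrite /y' jk.
have : c k * y k <= c k by rewrite ler_piMr ?(ltW (c0 k))//; case/andP: (y01 k).
lra.
Qed.

(** * The standard normal distribution function *)

Section Phi.
Context {R : realType}.
Notation mu := (@lebesgue_measure R).

Lemma Phi_EFin (x : R) : normal_prob 0 1 `]-oo, x] = (Phi x)%:E.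
Proof. by rewrite /Phi fineK// fin_num_measure. Qed.

Lemma derive_Phi (x : R) :
  derivable (@Phi R) x 1 /\ derive1 (@Phi R) x = normal_pdf 0 1 x.
Proof.
apply: (@continuous_FTC1 R (normal_pdf 0 1) -oo%O x (x + 1)).
- by rewrite ltrDl.
- apply: (integrableS measurableT) => //.
  exact: integrable_normal_pdf.
- by rewrite ltNyr.
- exact: continuous_normal_pdf (oner_neq0 _) x.
Qed.

Lemma continuous_Phi : continuous (@Phi R).
Proof.
move=> x; apply: differentiable_continuous; apply/derivable1_diffP.
exact: (derive_Phi x).1.
Qed.

Lemma Phi_lt (x y : R) : x < y -> Phi x < Phi y.
Proof.
move=> xy; apply: (@gtr0_derive1_incr R _ x y) => //.
- by move=> z _; exact: (derive_Phi z).1.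
- move=> z _; rewrite (derive_Phi z).2 normal_pdfE ?oner_eq0//.
  by rewrite mulr_gt0 ?expR_gt0// normal_peak_gt0// oner_eq0.
- by apply: continuous_subspaceT; exact: continuous_Phi.
Qed.

(** The density is even, so the two half-lines have equal mass. *)
Lemma Phi0 : Phi (0 : R) = 1 / 2.
Proof.
have even : normal_pdf (0 : R) 1 =1 normal_pdf 0 1 \o -%R.
  move=> x /=; rewrite !normal_pdfE ?oner_eq0// /normal_fun !subr0.
  by rewrite sqrrN.
have cont := @continuous_normal_pdf R 0 1 (oner_neq0 R).
have pos := @normal_pdf_ge0 R 0 1.
have := ge0_symfun_integralT pos cont even.
rewrite integral_normal_pdf -set_itvcy ge0_integration_by_substitution0; last 2 first.
- by apply/measurable_EFinP; exact: measurable_normal_pdf.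
- by move=> r; rewrite lee_fin.
under eq_integral => x _ do rewrite -[normal_pdf _ _ _]/((normal_pdf 0 1 \o -%R) x) -even.
rewrite -/(normal_prob 0 1 `]-oo, (0 : R)]) Phi_EFin -EFinM => -[] /esym.
lra.
Qed.

(** [Phi] is the distribution function of the identity under the standard
    normal law, so it tends to 0 and 1 at the two infinities; the rest is the
    intermediate value theorem. *)
Lemma Phi_surj (p : R) : 0 < p < 1 -> exists x, Phi x = p.
Proof.
move=> /andP[p0 p1].
pose idR : measurableTypeR R -> R := idfun.
pose X := HB.pack_for {mfun measurableTypeR R >-> R} idR
  (@isMeasurableFun.Build _ _ (measurableTypeR R) R idR (@measurable_id _ _ setT)).
have [u pu] : exists u, p < Phi u.
  have h := @cvg_cdfy1 _ _ R (normal_prob 0 1) X.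
  have : (p%:E < 1)%E by rewrite lte_fin.
  move=> /open_ereal_gt'/(h (fun y => (p%:E < y)%E)) -[M [_ MP]]; exists (M + 1).
  by rewrite -lte_fin -Phi_EFin; apply: MP; rewrite ltrDl.
have [v pv] : exists v, Phi v < p.
  have h := @cvg_cdfNy0 _ _ R (normal_prob 0 1) X.
  have : (0 < p%:E)%E by rewrite lte_fin.
  move=> /open_ereal_lt'/(h (fun y => (y < p%:E)%E)) -[M [_ MP]]; exists (M - 1).
  by rewrite -lte_fin -Phi_EFin; apply: MP; rewrite ltrBlDr ltrDl.
have vu : v <= u.
  by rewrite leNgt; apply/negP => /Phi_lt; rewrite ltNge (ltW (lt_trans pv pu)).
have [|x _ xp] := @IVT R (@Phi R) v u p vu (continuous_subspaceT continuous_Phi).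
  rewrite (min_idPl _) ?(max_idPr _) ?(ltW pv) ?(ltW pu)//;
  exact: (ltW (lt_trans pv pu)).
by exists x.
Qed.

Lemma Phi_invK (p : R) : 0 < p < 1 -> Phi (Phi_inv p) = p.
Proof.
by move=> p01; have [x xp] := Phi_surj p01; rewrite /Phi_inv; case: xgetP => [y -> //|/(_ x)].
Qed.

Lemma Phi_inv_ge0 (p : R) : 1 / 2 <= p < 1 -> 0 <= Phi_inv p.
Proof.
move=> /andP[p2 p1]; rewrite leNgt; apply/negP => /Phi_lt.
rewrite Phi0 Phi_invK; lra.
Qed.

Lemma normal_peakE (s : R) : 0 < s -> normal_peak s = s^-1 * normal_peak 1.
Proof.
move=> s0; rewrite /normal_peak expr1n mul1r -mulrnAr sqrtrM ?sqr_ge0//.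
by rewrite sqrtr_sqr ger0_norm ?(ltW s0)// invfM.
Qed.

Lemma normal_pdf_standardize (m s x : R) : 0 < s ->
  normal_pdf m s x = normal_pdf 0 1 ((x - m) / s) * s^-1.
Proof.
move=> s0; have sn : s != 0 by rewrite gt_eqF.
rewrite !normal_pdfE ?oner_eq0// normal_peakE// /normal_fun subr0 expr1n.
rewrite -mulrA mulrC; congr (_ * expR _ * _).
by field.
Qed.

(** Change of variable x = m + y * s. *)
Lemma normal_prob_standardize (m s q : R) : 0 < s ->
  normal_prob m s `]-oo, m + q * s] = (Phi q)%:E.
Proof.
move=> s0; have sn : s != 0 by rewrite gt_eqF.
pose F (x : R) : R := (x - m) / s.
have F' (x : R) : is_derive x (1 : R) F s^-1.
  rewrite /F; apply: is_derive_eq.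
  by rewrite scaler0 add0r subr0; exact: mulr1.
have F'E : derive1 F = cst s^-1.
  by apply/funext => x; rewrite derive1E; apply: derive_val.
have Fq : F (m + q * s) = q by rewrite /F; field.
have cF : continuous F.
  move=> x; apply: differentiable_continuous; apply/derivable1_diffP.
  by have [] := F' x.
rewrite -Phi_EFin /normal_prob -[in RHS]Fq.
rewrite (@increasing_ge0_integration_by_substitutionNy R F).
- apply: eq_integral => x _; congr EFin; rewrite F'E !fctE.
  exact: normal_pdf_standardize.
- by move=> x y _ _ xy; rewrite /F ltr_pM2r ?invr_gt0// ltrD2r.
- by rewrite F'E => x _; exact: cvg_cst.
- by rewrite F'E; exact: is_cvg_cst.
- by rewrite F'E; exact: cvg_cst.
- split; first by move=> x _; have [] := F' x.
  by apply: cvg_at_left_filter; exact: cF.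
- apply: gt0_cvgMlNy; first by rewrite invr_gt0.
  exact: cvg_addrr_Ny.
- apply: continuous_subspaceT; apply: continuous_normal_pdf; exact: oner_neq0.
- by move=> x _; exact: normal_pdf_ge0.
Qed.

End Phi.

(** * Convolution of normal laws *)

Section convolution.
Context {R : realType}.
Notation mu := (@lebesgue_measure R).
Notation RR := (measurableTypeR R).

Lemma lebesgue_measure_shift (a : R) (A : set R) : measurable A ->
  pushforward mu ((fun x => x + a) : _ -> RR) A = mu A.
Proof.
move=> mA; apply/esym.
have mshift : measurable_fun setT ((fun x => x + a) : RR -> RR).
  exact: measurable_funD.
apply: lebesgue_measure_unique => //= _ [[c b]] _ <-.
rewrite /pushforward (_ : _ @^-1` _ = `]c - a, b - a]%classic).
  by rewrite !lebesgue_measure_itv/= !lte_fin ltrD2r !EFinN -!EFinB; case: ifP => // _;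
     rewrite opprB addrA subrK.
by apply/seteqP; split => x /=; rewrite !in_itv/= ltrBlDr lerBrDr.
Qed.

Lemma normal_pdf_shift (m s a x : R) : s != 0 ->
  normal_pdf (m + a) s (x + a) = normal_pdf m s x.
Proof.
by move=> s0; rewrite !normal_pdfE// /normal_fun opprD addrACA subrr addr0.
Qed.

Lemma normal_prob_shift (m s a : R) (C : set R) : s != 0 -> measurable C ->
  normal_prob m s [set y | C (y + a)] = normal_prob (m + a) s C.
Proof.
move=> s0 mC; rewrite /normal_prob.
under eq_integral => x _ do rewrite -(normal_pdf_shift m a x s0).
have mshift : measurable_fun setT ((fun x => x + a) : RR -> RR).
  exact: measurable_funD.
rewrite -(@ge0_integral_pushforward _ _ _ _ R _ mshift mu C
  (fun x => (normal_pdf (m + a) s x)%:E))//.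
- by apply: eq_measure_integral => A mA _; exact: lebesgue_measure_shift.
- by apply/measurable_EFinP/measurable_funTS; exact: measurable_normal_pdf.
- by move=> x _; rewrite lee_fin normal_pdf_ge0.
Qed.

(** By uniqueness, the Radon-Nikodym derivative of a normal law with respect
    to the Lebesgue measure is almost everywhere its density. *)
Lemma integral_normal_prob (m s : R) (f : RR -> \bar R) :
  (normal_prob m s).-integrable setT f ->
  (\int[normal_prob m s]_x f x = \int[mu]_x (f x * (normal_pdf m s x)%:E))%E.
Proof.
move=> intf; have mf := measurable_int _ intf.
rewrite -(Radon_Nikodym_change_of_variables (normal_prob_dominates m s))//=.
apply: ae_eq_integral => //.
- apply: emeasurable_funM => //; apply: (measurable_int mu).
  by apply: Radon_Nikodym_integrable; exact: normal_prob_dominates.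
- by apply: emeasurable_funM => //=; apply/measurable_EFinP; exact: measurable_normal_pdf.
- apply: ae_eqe_mul2l => /=.
  apply: integral_ae_eq => //=.
  + by apply: Radon_Nikodym_integrable; exact: normal_prob_dominates.
  + by apply/measurable_EFinP; exact: measurable_normal_pdf.
  + move=> E _ mE; rewrite -Radon_Nikodym_integral//.
    exact: normal_prob_dominates.
Qed.

(** Completing the square in x. For s1 and s2 standard deviations of
    independent weights with means m1 and m2, the last factor is the density of
    the first weight conditioned on the total being z. *)
Lemma normal_pdf_convolution (m1 m2 s1 s2 z x : R) : 0 < s1 -> 0 < s2 ->
  let s := Num.sqrt (s1 ^+ 2 + s2 ^+ 2) in
  normal_pdf m2 s2 (z - x) * normal_pdf m1 s1 x =
  normal_pdf (m1 + m2) s z *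
  normal_pdf ((m1 * s2 ^+ 2 + (z - m2) * s1 ^+ 2) / s ^+ 2) (s1 * s2 / s) x.
Proof.
move=> s10 s20 s.
have s0 : 0 < s by rewrite sqrtr_gt0 addr_gt0// exprn_gt0.
have sE : s ^+ 2 = s1 ^+ 2 + s2 ^+ 2.
  by rewrite sqr_sqrtr// addr_ge0 ?sqr_ge0.
have t0 : 0 < s1 * s2 / s by rewrite divr_gt0 ?mulr_gt0.
rewrite !normal_pdfE ?gt_eqF//.
rewrite (normal_peakE s10) (normal_peakE s20) (normal_peakE s0) (normal_peakE t0).
rewrite /normal_fun mulrACA [RHS]mulrACA -!expRD; congr (_ * expR _).
  by field; rewrite !gt_eqF.
rewrite expr_div_n sE; field.
rewrite !gt_eqF//= addr_gt0// exprn_gt0//.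
Qed.

(** Exchanging the two integrals leaves, for each z, the integral over x of the
    product computed in [normal_pdf_convolution], where the conditional density
    integrates to 1. *)
Lemma normal_prob_convolution (m1 m2 s1 s2 : R) (C : set R) :
  0 < s1 -> 0 < s2 -> measurable C ->
  (\int[normal_prob m1 s1]_x normal_prob (m2 + x) s2 C)%E =
  normal_prob (m1 + m2) (Num.sqrt (s1 ^+ 2 + s2 ^+ 2)) C.
Proof.
move=> s10 s20 mC; set s := Num.sqrt _.
have s2n : s2 != 0 by rewrite gt_eqF.
have mpdf : measurable_fun [set: RR * RR]
    (fun z => normal_pdf m2 s2 (z.2 - z.1)).
  apply: (@measurableT_comp _ _ _ _ _ _ (normal_pdf m2 s2)).
    exact: measurable_normal_pdf.
  by apply: measurable_funB; [exact: measurable_snd|exact: measurable_fst].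
pose f (z : RR * RR) := (normal_pdf m2 s2 (z.2 - z.1) * \1_C z.2)%:E.
have mf : measurable_fun setT f.
  apply/measurable_EFinP; apply: measurable_funM => //.
  by apply: (@measurableT_comp _ _ _ _ _ _ (\1_C : RR -> R)); [exact: measurable_indic|exact: measurable_snd].
have f0 z : (0 <= f z)%E by rewrite lee_fin mulr_ge0// normal_pdf_ge0.
transitivity (\int[normal_prob m1 s1]_x \int[mu]_z f (x, z))%E.
  apply: eq_integral => x _; rewrite /normal_prob.
  rewrite integral_mkcond; apply: eq_integral => z _.
  rewrite /f/= patchE indicE -{2}(subrK x z) normal_pdf_shift//.
  by case: ifP; rewrite ?mulr1 ?mulr0.
rewrite (@fubini_tonelli _ _ _ _ _ (normal_prob m1 s1) mu f)//.
rewrite /normal_prob [RHS]integral_mkcond; apply: eq_integral => z _.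
rewrite patchE /f/= indicE; case: ifP => zC; last first.
  by under eq_integral do rewrite mulr0; rewrite integral0.
under eq_integral do rewrite mulr1.
have mz : measurable_fun [set: RR] (fun x => normal_pdf m2 s2 (z - x)).
  apply: (@measurableT_comp _ _ _ _ _ _ (normal_pdf m2 s2)).
    exact: measurable_normal_pdf.
  exact: measurable_funB.
rewrite integral_normal_prob; last first.
  apply: (@le_integrable _ _ _ (normal_prob m1 s1) setT _ _
    (cst (normal_peak s2)%:E)) => //.
  - exact/measurable_EFinP.
  - move=> x _ /=; rewrite lee_fin !ger0_norm ?normal_peak_ge0//.
      exact: normal_pdf_ub.
    exact: normal_pdf_ge0.
  - exact: finite_measure_integrable_cst.
under eq_integral => x _ do rewrite -EFinM normal_pdf_convolution// EFinM.
rewrite ge0_integralZl//=.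
- by rewrite integral_normal_pdf mule1.
- by apply/measurable_EFinP; exact: measurable_normal_pdf.
- by move=> x _; rewrite lee_fin normal_pdf_ge0.
- by rewrite lee_fin normal_pdf_ge0.
Qed.

End convolution.

Section normal_law.
Context {R : realType}.
Notation RR := (measurableTypeR R).

(** Packaging the degenerate case with the others makes one probability
    measure out of the two branches of [has_normal_law], so that sums of
    weights need no case analysis on which of them are deterministic. *)
Definition normal_law (m s : R) : probability RR R :=
  if s == 0 then (dirac (m : RR) : probability RR R)
  else (normal_prob m s : probability RR R).

Lemma normal_lawE (m s : R) (B : set R) :
  normal_law m s B = if s == 0 then dirac (m : RR) B else normal_prob m s B.
Proof. by rewrite /normal_law; case: ifP. Qed.

Lemma normal_law_shift (m s a : R) (C : set R) : measurable C ->
  normal_law m s [set y | C (y + a)] = normal_law (m + a) s C.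
Proof.
move=> mC; rewrite !normal_lawE; case: ifPn => [_|s0]; last exact: normal_prob_shift.
by rewrite !diracE; congr (_%:R%:E).
Qed.

(** A constant summand only translates the other law; if neither summand is
    constant, the densities are convolved. *)
Lemma normal_law_convolution (m1 m2 s1 s2 : R) (C : set R) :
  0 <= s1 -> 0 <= s2 -> measurable C ->
  (normal_law m1 s1 \x normal_law m2 s2)%E [set z | C (z.1 + z.2)] =
  normal_law (m1 + m2) (Num.sqrt (s1 ^+ 2 + s2 ^+ 2)) C.
Proof.
move=> s10 s20 mC.
have mshift a : measurable [set y : RR | C (y + a)].
  have : measurable_fun setT ((fun x => x + a) : RR -> RR).
    exact: measurable_funD.
  by move=> /(_ measurableT C mC); rewrite setTI.
have mA : measurable [set z : RR * RR | C (z.1 + z.2)].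
  have : measurable_fun setT (fun z : RR * RR => (z.1 + z.2 : RR)).
    by apply: measurable_funD; [exact: measurable_fst|exact: measurable_snd].
  by move=> /(_ measurableT C mC); rewrite setTI.
have sectionE (x : RR) : normal_law m2 s2 (xsection [set z | C (z.1 + z.2)] x) =
    normal_law (m2 + x) s2 C.
  rewrite -normal_law_shift//; congr (normal_law m2 s2 _).
  by apply/seteqP; split => y; rewrite /xsection/= inE/= addrC.
have mlaw : measurable_fun [set: RR] (fun x => normal_law (m2 + x) s2 C).
  apply: eq_measurable_fun (measurable_fun_xsection (normal_law m2 s2) mA).
  by move=> x _; exact: sectionE.
transitivity (\int[normal_law m1 s1]_x normal_law (m2 + x) s2 C)%E.
  by apply: eq_integral => x _; exact: sectionE.
have [s1E|s1n] := eqVneq s1 0.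
  rewrite s1E expr0n add0r sqrtr_sqr ger0_norm//.
  rewrite {1}/normal_law eqxx integral_dirac//= diracE.
  by rewrite mem_set// mul1e addrC.
have [s2E|s2n] := eqVneq s2 0.
  rewrite s2E expr0n addr0 sqrtr_sqr ger0_norm// -normal_law_shift//.
  transitivity (\int[normal_law m1 s1]_x (\1_[set y | C (y + m2)] x)%:E)%E.
    apply: eq_integral => x _; by rewrite normal_lawE eqxx diracE indicE addrC.
  by rewrite integral_indic// setIT.
have s1p : 0 < s1 by rewrite lt_neqAle eq_sym s1n.
have s2p : 0 < s2 by rewrite lt_neqAle eq_sym s2n.
have ss : Num.sqrt (s1 ^+ 2 + s2 ^+ 2) != 0.
  by rewrite gt_eqF// sqrtr_gt0 addr_gt0// exprn_gt0.
rewrite [RHS]normal_lawE (negbTE ss) -normal_prob_convolution//.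
rewrite {1}/normal_law (negbTE s1n); apply: eq_integral => x _.
by rewrite normal_lawE (negbTE s2n).
Qed.

Lemma normal_law_quantile (m s b p : R) : 0 <= s -> 0 < p < 1 ->
  m + Phi_inv p * s <= b -> (p%:E <= normal_law m s `]-oo, b]%classic)%E.
Proof.
move=> s0 p01 mb; rewrite normal_lawE; have [sE|sn] := eqVneq s 0.
  rewrite diracE mem_set ?lee_fin; first by case/andP: p01 => _ /ltW.
  by rewrite /= in_itv/=; move: mb; rewrite sE mulr0 addr0.
have sp : 0 < s by rewrite lt_neqAle eq_sym sn.
rewrite -{1}(Phi_invK p01) -(normal_prob_standardize m _ sp).
by apply: le_measure; rewrite ?inE//; exact: subset_itvl.
Qed.

End normal_law.

(** * Sums of independent normal variables *)

Section joint_law.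
Context d (T : measurableType d) (R : realType).
Notation RR := (measurableTypeR R).

(** The law of a pair (U, V) under a finite measure Q is determined by its
    values on rectangles. Allowing Q to be other than a probability makes it
    possible to work on an event, by restriction, without conditioning. *)
Lemma joint_law_product (Q : {finite_measure set T -> \bar R})
    (N1 N2 : probability RR R) (U V : T -> RR) :
  measurable_fun setT U -> measurable_fun setT V ->
  (forall A B, measurable A -> measurable B ->
    Q [set w | A (U w) /\ B (V w)] = (Q setT * (N1 A * N2 B))%E) ->
  forall D : set (RR * RR), measurable D ->
    Q [set w | D (U w, V w)] = (Q setT * (N1 \x N2) D)%E.
Proof.
move=> mU mV QE D mD.
have mUV : measurable_fun setT (fun w => (U w, V w)).
  exact: measurable_fun_pair.
have mpre (D' : set (RR * RR)) : measurable D' -> measurable [set w | D' (U w, V w)].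
  by move=> mD'; have := mUV measurableT D' mD'; rewrite setTI.
have finQ : Q setT \is a fin_num by exact: fin_num_measure.
have [Q0|Qn0] := eqVneq (Q setT) 0%E.
  rewrite Q0 mul0e; apply/eqP; rewrite -measure_le0 -Q0.
  by apply: le_measure; rewrite ?inE//; exact: mpre.
(* Dividing by the total mass reduces to product measures of probabilities. *)
have r0 : 0 < fine (Q setT) by rewrite fine_gt0// lt0e Qn0 measure_ge0 ltey_eq finQ.
have ri : 0 <= (fine (Q setT))^-1 by rewrite invr_ge0 ltW.
have QK x : ((fine (Q setT))^-1%:E * (Q setT * x) = x)%E.
  by rewrite muleA -[X in (_ * X * _)%E](fineK finQ) -EFinM mulVf ?mul1e// gt_eqF.
pose m' := mscale (NngNum ri) (pushforward Q (fun w => (U w, V w))).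
rewrite (@product_measure_unique _ _ _ _ R N1 N2 (m' mUV))//.
  rewrite [X in (_ * X)%E](_ : _ = ((fine (Q setT))^-1%:E * Q [set w | D (U w, V w)])%E)//.
  by rewrite muleCA QK.
move=> A B mA mB; rewrite /m'/= /mscale/= /pushforward/=.
by rewrite -[X in (_ * X)%E]/(Q [set w | A (U w) /\ B (V w)]) QE// QK.
Qed.

End joint_law.

Section sum_of_normals.
Context d (T : measurableType d) (R : realType) (P : probability T R) (n : nat).
Variables (a sigma : 'I_n -> R) (X : 'I_n -> {RV P >-> R}).
Hypothesis sigma_ge0 : forall j, 0 <= sigma j.
Hypothesis law_X : forall j, has_normal_law P (X j) (a j) (sigma j).
Hypothesis indep_X : mutually_independent P X.
Notation RR := (measurableTypeR R).

Definition cylinder (J : {set 'I_n}) (B : 'I_n -> set R) : set T :=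
  [set w | forall j, j \in J -> B j (X j w)].

Lemma measurable_cylinder J B : (forall j, measurable (B j)) ->
  measurable (cylinder J B).
Proof.
move=> mB; rewrite (_ : cylinder J B =
    \big[setI/setT]_(j <- enum J) (X j @^-1` B j)).
  apply: bigsetI_measurable => j _; exact: measurable_funPTI.
rewrite -bigcap_seq; apply/seteqP; split => w h j; rewrite /= ?mem_enum => Jj.
  by apply: h.
by apply: (h j); rewrite /= mem_enum.
Qed.

Lemma law_XE j (B : set R) : measurable B ->
  P (X j @^-1` B) = normal_law (a j) (sigma j) B.
Proof. by move=> mB; rewrite normal_lawE; exact: law_X. Qed.

(** The sum over s is not only normal but also independent of the events that
    involve the other variables. This stronger form is what the induction
    needs: the variable that joins the sum comes out of the event, so the
    hypothesis is applied with k added to J. *)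
Lemma law_sum_indep (s : seq 'I_n) (J : {set 'I_n}) (B : 'I_n -> set R)
    (A : set R) :
  uniq s -> (forall j, j \in s -> j \notin J) ->
  (forall j, measurable (B j)) -> measurable A ->
  P ([set w | A (\sum_(j <- s) X j w)] `&` cylinder J B) =
  (P (cylinder J B) * normal_law (\sum_(j <- s) a j)
     (Num.sqrt (\sum_(j <- s) sigma j ^+ 2)) A)%E.
Proof.
elim: s => [|k s IH] in J B A *.
  move=> _ _ mB mA; under eq_set do rewrite big_nil.
  rewrite !big_nil sqrtr0 normal_lawE eqxx diracE.
  have [A0|nA0] := boolP ((0 : R) \in A).
    rewrite mule1; congr (P _); apply/seteqP; split => w /=; first by case.
    by split=> //; exact: set_mem.
  rewrite mule0 -(measure0 P); congr (P _); apply/seteqP; split => w //= -[].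
  by move=> A0; rewrite mem_set in nA0.
rewrite cons_uniq => /andP[ks us] sJ mB mA.
pose S w : RR := \sum_(j <- s) X j w.
have mS : measurable_fun setT S by apply: measurable_sum.
have mXk : measurable_fun setT (X k : T -> RR) by exact: (@measurable_funPT _ _ _ _ (X k)).
have mE := measurable_cylinder J mB.
have Efin : (P (cylinder J B) < +oo)%E by rewrite ltey_eq fin_num_measure.
pose Q : {finite_measure set T -> \bar R} := mfrestr mE Efin.
have QT : Q setT = P (cylinder J B) by rewrite /Q/= /mfrestr/= /mrestr setTI.
set m := \sum_(j <- s) a j in IH *; set v := \sum_(j <- s) _ in IH *.
have kJ : k \notin J by apply: sJ; rewrite mem_head.
have rect A1 B1 : measurable A1 -> measurable B1 ->
    Q [set w | A1 (S w) /\ B1 (X k w)] =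
    (Q setT * (normal_law m (Num.sqrt v) A1 * normal_law (a k) (sigma k) B1))%E.
  move=> mA1 mB1; pose B' j := if j == k then B1 else B j.
  have mB' j : measurable (B' j) by rewrite /B'; case: ifP.
  have cylE : cylinder (k |: J) B' = X k @^-1` B1 `&` cylinder J B.
    apply/seteqP; split => [w h|w [hk hJ] j].
      split=> [|j jJ]; first by have := h k; rewrite /B' eqxx; apply; rewrite setU11.
      have := h j; rewrite /B'; case: eqVneq => [jk|_]; first by rewrite -jk jJ in kJ.
      by apply; rewrite in_setU1 jJ orbT.
    by rewrite in_setU1 /B'; case: eqVneq => [->//|_] /= /hJ.
  have -> : Q [set w | A1 (S w) /\ B1 (X k w)] =
      P ([set w | A1 (\sum_(j <- s) X j w)] `&` cylinder (k |: J) B').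
    rewrite cylE setIA; congr (P _).
  rewrite IH//; last first.
    move=> j js; rewrite in_setU1 negb_or sJ ?in_cons ?js ?orbT// andbT.
    by apply: contraNneq ks => <-.
  rewrite QT /cylinder !indep_X// big_setU1//= {1}/B' eqxx law_XE//.
  rewrite (eq_bigr (fun j => P (X j @^-1` B j))) => [|j jJ]; last first.
    by rewrite /B'; case: eqVneq => // jk; rewrite -jk jJ in kJ.
  by rewrite muleC [RHS]muleCA; congr (_ * _)%E; exact: muleC.
have mD : measurable [set z : RR * RR | A (z.1 + z.2)].
  have : measurable_fun setT (fun z : RR * RR => (z.1 + z.2 : RR)).
    by apply: measurable_funD; [exact: measurable_fst|exact: measurable_snd].
  by move=> /(_ measurableT A mA); rewrite setTI.
transitivity (Q [set w | [set z : RR * RR | A (z.1 + z.2)] (S w, X k w)]).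
  rewrite /Q/= /mfrestr/= /mrestr; congr (P (_ `&` _)).
  by apply/seteqP; split => w /=; rewrite big_cons addrC.
have -> := @joint_law_product _ _ R Q _ _ S (X k) mS mXk rect _ mD.
rewrite QT; congr (_ * _)%E.
rewrite normal_law_convolution; [|exact: sqrtr_ge0|exact: sigma_ge0|exact: mA].
rewrite !big_cons sqr_sqrtr; last by apply: sumr_ge0 => j _; exact: sqr_ge0.
by rewrite addrC [v + _]addrC.
Qed.

(** For a 0/1 point the weighted sums range over the chosen items only, and
    [g_NC] is the mean plus the quantile times the standard deviation of their
    total weight. *)
Lemma g_NC_chance_constraint (b rho : R) (x : 'I_n -> R) :
  0 < rho < 1 -> (forall j, x j = 0 \/ x j = 1) ->
  g_NC a sigma rho x <= b -> CKP_feasible P X b rho x.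
Proof.
move=> rho01 x01 gx; split=> //.
pose s := enum [set j | x j == 1]%SET.
have sumE (u : 'I_n -> R) : \sum_(j < n) u j * x j = \sum_(j <- s) u j.
  rewrite big_enum/= [RHS]big_mkcond/=; apply: eq_bigr => j _.
  rewrite inE; case: (x01 j) => ->; first by rewrite mulr0 eq_sym oner_eq0.
  by rewrite mulr1 eqxx.
have -> : [set w | \sum_(j < n) X j w * x j <= b] =
    [set w | `]-oo, b]%classic (\sum_(j <- s) X j w)] `&`
    cylinder finset.set0 (fun=> setT).
  apply/seteqP; split => w /=; rewrite in_itv/= sumE; last by case.
  by split=> // j; rewrite finset.in_set0.
have P1 : P (cylinder finset.set0 (fun=> setT)) = 1%E.
  rewrite -(probability_setT P); congr (P _).
  by apply/seteqP; split => // w _ j.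
rewrite law_sum_indep//; [|exact: enum_uniq|by move=> j _; rewrite finset.in_set0].
rewrite P1 mul1e; apply: normal_law_quantile => //.
by rewrite -!sumE.
Qed.

End sum_of_normals.

(** * The approximation bound *)

Theorem theorem2 (R : realType) (d : measure_display) (T : measurableType d)
    (P : probability T R) (n : nat)
    (c a sigma : 'I_n -> R) (atil : 'I_n -> {RV P >-> R}) (b rho : R)
    (hc : forall j, 0 < c j)
    (ha : forall j, 0 < a j)
    (hsigma : forall j, 0 <= sigma j)
    (hlaw : forall j, has_normal_law P (atil j) (a j) (sigma j))
    (hind : mutually_independent P atil)
    (hb : 0 < b)
    (hrho : 1 / 2 <= rho)
    (hrho1 : rho < 1)
    (hall : b < \sum_(j < n) a j
                + Phi_inv rho * Num.sqrt (\sum_(j < n) sigma j ^+ 2))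
    (hone : forall j, a j + Phi_inv rho * sigma j <= b) :
  z_NC c a sigma b rho <= 2 * z_OPT P c atil b rho.
Proof.
have q0 : 0 <= Phi_inv rho by apply: Phi_inv_ge0; rewrite hrho.
have [_ OPT_max] := @z_OPT_max _ _ _ P _ c atil _ _ hb (ltW hrho1).
have [[x xNC <-] _] := @z_NC_max _ _ c a sigma _ rho hb.
apply: (NC_profit_le_double hc ha hsigma q0 hone _ xNC) => y y01 gy.
apply: OPT_max; exists y => //.
apply: (g_NC_chance_constraint hsigma hlaw hind _ y01 gy).
by rewrite hrho1 andbT; lra.
Qed.
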